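(* There exists an idempotent variety $\mathcal V$ with a majority term such that TImC fails in $\mathcal V$ and $\mathcal V$ is generated by a three-element algebra.
   Context: A variety $\mathcal V$ is idempotent if $t(x,\ldots,x)\approx x$ is an identity of $\mathcal V$ for every basic operation $t$. A majority term of $\mathcal V$ is a ternary term $m$ such that the identities $m(x,x,y)\approx x$, $m(x,y,x)\approx x$ and $m(y,x,x)\approx x$ hold in $\mathcal V$. A tolerance of an algebra $\mathbf A=(A;F)$ is a reflexive, symmetric relation $\tau\subseteq A^2$ compatible with all operations in $F$. If $\phi\colon\mathbf B\to\mathbf A$ is a homomorphism and $\vartheta\subseteq B^2$, write $\phi(\vartheta)=\{(\phi(a),\phi(b)):(a,b)\in\vartheta\}$. A variety $\mathcal V$ satisfies TImC (its tolerances are homomorphic images of its congruences) if for every $\mathbf A\in\mathcal V$ and every tolerance $\tau$ of $\mathbf A$ there exist an algebra $\mathbf B\in\mathcal V$, a congruence $\vartheta$ of $\mathbf B$, and a homomorphism $\phi\colon\mathbf B\to\mathbf A$ such that $\tau=\phi(\vartheta)$; otherwise TImC fails in $\mathcal V$. *)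

(* Defs.v *)
From mathcomp Require Import all_boot.
From Stdlib Require Import RelationClasses.

Set Implicit Arguments.
Unset Strict Implicit.
Unset Printing Implicit Defensive.

Record signature := Signature {
  symbol : Type;
  arity : symbol -> nat
}.

Record algebra (S : signature) := Algebra {
  carrier :> Type;
  carrier_nonempty : inhabited carrier;
  op : forall f : symbol S, ('I_(arity f) -> carrier) -> carrier
}.
Arguments op {S} A f args : rename.

Inductive term (S : signature) (X : Type) :=
| Var (x : X)
| App (f : symbol S) (args : 'I_(arity f) -> term S X).
Arguments Var {S X} x.
Arguments App {S X} f args.

Fixpoint eval (S : signature) (A : algebra S) (X : Type) (v : X -> A)
    (t : term S X) : A :=
  match t with
  | Var x => v x
  | App f args => op A f (fun i => eval v (args i))
  end.

Fixpoint subst (S : signature) (X Y : Type) (r : X -> term S Y)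
    (t : term S X) : term S Y :=
  match t with
  | Var x => r x
  | App f args => App f (fun i => subst r (args i))
  end.

(* The term m(t0, t1, t2), for a ternary term m. *)
Definition subst3 (S : signature) (X : Type) (m : term S 'I_3)
    (t0 t1 t2 : term S X) : term S X :=
  subst (fun i : 'I_3 => nth t0 [:: t0; t1; t2] i) m.

Definition satisfies (S : signature) (A : algebra S) (s t : term S nat) : Prop :=
  forall v : nat -> A, eval v s = eval v t.

Definition alg_class (S : signature) := algebra S -> Prop.

Definition is_variety (S : signature) (V : alg_class S) : Prop :=
  exists E : term S nat -> term S nat -> Prop,
    forall A : algebra S, V A <-> (forall s t, E s t -> satisfies A s t).

Definition is_identity (S : signature) (V : alg_class S) (s t : term S nat) : Prop :=
  forall A : algebra S, V A -> satisfies A s t.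

Definition generated_by (S : signature) (V : alg_class S) (A : algebra S) : Prop :=
  [/\ is_variety V, V A &
      forall W : alg_class S, is_variety W -> W A ->
        forall B : algebra S, V B -> W B].

Definition idempotent_class (S : signature) (V : alg_class S) : Prop :=
  forall f : symbol S, is_identity V (App f (fun=> Var 0)) (Var 0).

Definition majority_term (S : signature) (V : alg_class S) (m : term S 'I_3) : Prop :=
  let x := Var 0 in
  let y := Var 1 in
  [/\ is_identity V (subst3 m x x y) x,
      is_identity V (subst3 m x y x) x &
      is_identity V (subst3 m y x x) x].

Definition compatible (S : signature) (A : algebra S) (r : A -> A -> Prop) : Prop :=
  forall (f : symbol S) (a b : 'I_(arity f) -> A),
    (forall i, r (a i) (b i)) -> r (op A f a) (op A f b).

Definition tolerance (S : signature) (A : algebra S) (r : A -> A -> Prop) : Prop :=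
  [/\ Reflexive r, Symmetric r & compatible r].

Definition congruence (S : signature) (A : algebra S) (r : A -> A -> Prop) : Prop :=
  Equivalence r /\ compatible r.

Definition homomorphism (S : signature) (B A : algebra S) (phi : B -> A) : Prop :=
  forall (f : symbol S) (b : 'I_(arity f) -> B),
    phi (op B f b) = op A f (fun i => phi (b i)).

Definition image_rel (B A : Type) (phi : B -> A) (r : B -> B -> Prop) (a a' : A) : Prop :=
  exists b b' : B, [/\ r b b', phi b = a & phi b' = a'].

Definition TImC (S : signature) (V : alg_class S) : Prop :=
  forall A : algebra S, V A ->
  forall tau : A -> A -> Prop, tolerance tau ->
  exists (B : algebra S) (theta : B -> B -> Prop) (phi : B -> A),
    [/\ V B, congruence theta, homomorphism phi &
        forall a a' : A, tau a a' <-> image_rel phi theta a a'].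

(* Main.v *)
Require Import Defs.
From mathcomp Require Import all_boot.
From Stdlib Require Import FunctionalExtensionality IndefiniteDescription.

(** TImC forces a condition on term operations. Let s and t be terms in paired
    variables that become equal in the variety once the two members of every
    pair are identified. If a tolerance [tau] is the image of a congruence
    [theta], then pairs [tau a b] lift to pairs of [theta]; modulo [theta] the
    values of s and t on the lifted pairs agree, because there the members of
    each pair are identified. Hence s and t must take [tau]-related values on
    any family of [tau]-related pairs ([TImC_paired_terms]).

    The three-element algebra is built to violate this. On Low, Mid, High let
    [near] be the relation missing only the pair of Low and High. The
    quadruple (Low, Mid, Mid, High) consists of two [near] pairs, and neither
    pair has equal members; so two operations may differ there and still agree
    on all quadruples (x, x, y, y). Let one take the value Low there and the
    other High, both being idempotent and Mid everywhere else. Since the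
    quadruple is far from both constant quadruples (Low, ..., Low) and
    (High, ..., High), each operation separately preserves [near]. The ternary
    median preserves [near] too and is a majority operation. The variety
    generated by this algebra is therefore the desired one, and TImC already
    fails for [near] on the generator. *)

Set Implicit Arguments.
Unset Strict Implicit.
Unset Printing Implicit Defensive.

(** * The variety generated by an algebra *)

Definition variety_of (S : signature) (A : algebra S) : alg_class S :=
  fun B => forall s t, satisfies A s t -> satisfies B s t.

Lemma generated_by_variety_of (S : signature) (A : algebra S) :
  generated_by (variety_of A) A.
Proof.
split; [by exists (satisfies A) | by [] |].
move=> W [E WE] WA B VB; apply/WE => s t Est.
exact/VB/((WE A).1 WA).
Qed.

(** * A consequence of TImC for terms *)

Lemma eval_homomorphism (S : signature) (B A : algebra S) (phi : B -> A)
    (X : Type) (v : X -> B) (t : term S X) :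
  homomorphism phi -> phi (eval v t) = eval (phi \o v) t.
Proof.
move=> hom; elim: t => [//|f args IH] /=.
rewrite hom; congr (op A f).
exact: functional_extensionality.
Qed.

Lemma eval_subst_compatible (S : signature) (B : algebra S)
    (theta : B -> B -> Prop) (X Y : Type) (r : X -> term S Y)
    (u : X -> B) (v : Y -> B) (t : term S X) :
  compatible theta -> (forall x, theta (u x) (eval v (r x))) ->
  theta (eval u t) (eval v (subst r t)).
Proof. by move=> comp uv; elim: t => [//|f args IH] /=; apply: comp. Qed.

(** Variables 2i and 2i+1 form the i-th pair; the substitution [half_var]
    identifies the members of each pair. *)
Definition interleave (T : Type) (a b : nat -> T) (k : nat) : T :=
  if odd k then b k./2 else a k./2.

Definition half_var (S : signature) (k : nat) : term S nat := Var k./2.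

(** Choosing [theta]-related preimages of all pairs at once, both terms become
    [theta]-related to their value at the first members of the pairs. *)
Lemma TImC_paired_terms (S : signature) (V : alg_class S) (A : algebra S)
    (tau : A -> A -> Prop) (s t : term S nat) (a b : nat -> A) :
  TImC V -> V A -> tolerance tau ->
  is_identity V (subst (@half_var S) s) (subst (@half_var S) t) ->
  (forall i, tau (a i) (b i)) ->
  tau (eval (interleave a b) s) (eval (interleave a b) t).
Proof.
move=> timc VA tolA st ab.
have [B [theta [phi [VB [equiv comp] hom tauE]]]] := timc A VA tau tolA.
have [refl sym trans] := equiv.
have [p pP] : exists p : nat -> B * B, forall i,
    [/\ theta (p i).1 (p i).2, phi (p i).1 = a i & phi (p i).2 = b i].
  apply: (functional_choice (fun i (q : B * B) =>
    [/\ theta q.1 q.2, phi q.1 = a i & phi q.2 = b i])) => i.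
  have [x [y xy]] := (tauE _ _).1 (ab i).
  by exists (x, y).
pose x i := (p i).1; pose w := interleave x (fun i => (p i).2).
have phi_w : phi \o w = interleave a b.
  apply: functional_extensionality => k /=.
  by rewrite /w /interleave; have [_ <- <-] := pP k./2; case: ifP.
have wx k : theta (w k) (x k./2).
  rewrite /w /interleave; case: ifP => _; last exact: refl.
  by apply: sym; have [] := pP k./2.
apply/tauE; exists (eval w s), (eval w t).
split; [|by rewrite eval_homomorphism // phi_w..].
apply: (trans _ (eval x (subst (@half_var S) s))).
  exact: eval_subst_compatible.
rewrite (st B VB x); apply: sym.
exact: eval_subst_compatible.
Qed.

(** * The three-element algebra *)

Inductive point := Low | Mid | High.

Definition near (x y : point) : bool :=
  match x, y with
  | Low, High | High, Low => false
  | _, _ => true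
  end.

(** The median for Low < Mid < High. *)
Definition median (x y z : point) : point :=
  match x, y, z with
  | Low, Low, _ | Low, _, Low | _, Low, Low => Low
  | High, High, _ | High, _, High | _, High, High => High
  | _, _, _ => Mid
  end.

Definition skew (e x y z w : point) : point :=
  match x, y, z, w with
  | Low, Mid, Mid, High => e
  | Low, Low, Low, Low => Low
  | High, High, High, High => High
  | _, _, _, _ => Mid
  end.

(** Two triples with medians Low and High have a common position where one
    contains Low and the other High. *)
Lemma near_median x y z x' y' z' :
  near x x' -> near y y' -> near z z' ->
  near (median x y z) (median x' y' z').
Proof.
by case: x x' => [] [] // _; case: y y' => [] [] // _; case: z z' => [] [].
Qed.

(** The exceptional quadruple contains both Low and High, so it is not near a
    constant quadruple on which the operation takes an extreme value. *)
Lemma near_skew e x y z w x' y' z' w' :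
  near x x' -> near y y' -> near z z' -> near w w' ->
  near (skew e x y z w) (skew e x' y' z' w').
Proof.
case: x x' => [] [] // _; case: y y' => [] [] // _;
by case: z z' => [] [] // _; case: w w' => [] [] // _; case: e.
Qed.

Inductive skew_symbol := Median | SkewLow | SkewHigh.

Definition skew_sig : signature :=
  Signature (fun f => match f with Median => 3 | _ => 4 end).

Definition skew_op (f : symbol skew_sig) :
    ('I_(arity f) -> point) -> point :=
  match f with
  | Median => fun x : 'I_3 -> point =>
      median (x (@Ordinal 3 0 isT)) (x (@Ordinal 3 1 isT)) (x (@Ordinal 3 2 isT))
  | SkewLow => fun x : 'I_4 -> point =>
      skew Low (x (@Ordinal 4 0 isT)) (x (@Ordinal 4 1 isT))
        (x (@Ordinal 4 2 isT)) (x (@Ordinal 4 3 isT))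
  | SkewHigh => fun x : 'I_4 -> point =>
      skew High (x (@Ordinal 4 0 isT)) (x (@Ordinal 4 1 isT))
        (x (@Ordinal 4 2 isT)) (x (@Ordinal 4 3 isT))
  end.

Definition skew_algebra : algebra skew_sig := Algebra (inhabits Low) skew_op.

Lemma point_bijection : exists e : 'I_3 -> point, bijective e.
Proof.
exists (fun i => nth Low [:: Low; Mid; High] i).
exists (fun x => match x with
  | Low => @Ordinal 3 0 isT
  | Mid => @Ordinal 3 1 isT
  | High => @Ordinal 3 2 isT
  end); last by case.
by move=> [[|[|[|]]] //= lt_i]; apply: val_inj.
Qed.

Lemma skew_algebra_idempotent : idempotent_class (variety_of skew_algebra).
Proof. by move=> f A; apply; case: f => v /=; case: (v 0). Qed.

Lemma skew_algebra_majority :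
  majority_term (variety_of skew_algebra) (App (Median : symbol skew_sig) Var).
Proof.
by split=> A; apply=> v /=; case: (v 0); case: (v 1).
Qed.

Lemma near_tolerance : tolerance (near : skew_algebra -> skew_algebra -> Prop).
Proof.
split; [by case | by case=> [] [] |].
by case=> a b ab /=; [apply: near_median | apply: near_skew..]; apply: ab.
Qed.

Lemma skew_algebra_not_TImC : ~ TImC (variety_of skew_algebra).
Proof.
move=> timc.
pose quad (f : symbol skew_sig) : term skew_sig nat :=
  App f (fun i => Var (nat_of_ord i)).
have agree : is_identity (variety_of skew_algebra)
    (subst (@half_var _) (quad SkewLow)) (subst (@half_var _) (quad SkewHigh)).
  by move=> A; apply=> v /=; case: (v 0); case: (v 1).
(* Interleaving these sequences gives Low, Mid, Mid, High in positions 0 to 3. *)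
pose a : nat -> skew_algebra := nth Mid [:: Low; Mid].
pose b : nat -> skew_algebra := nth Mid [:: Mid; High].
have near_ab i : near (a i) (b i) by case: i => [|[|[|i]]].
by have := TImC_paired_terms timc (fun _ _ => id) near_tolerance agree near_ab.
Qed.

Theorem proposition5p1 :
  exists (S : signature) (V : alg_class S),
    [/\ is_variety V,
        idempotent_class V,
        exists m : term S 'I_3, majority_term V m,
        ~ TImC V &
        exists A : algebra S,
          (exists e : 'I_3 -> A, bijective e) /\ generated_by V A].
Proof.
have gen := generated_by_variety_of skew_algebra.
exists skew_sig, (variety_of skew_algebra); split.
- by case: gen.
- exact: skew_algebra_idempotent.
- by exists (App (Median : symbol skew_sig) Var); apply: skew_algebra_majority.
- exact: skew_algebra_not_TImC.
- by exists skew_algebra; split; [apply: point_bijection | apply: gen].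
Qed.
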